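(* Let $G$ be a Carnot group and $\mathcal S\subset G$ an oriented $C^2$ hypersurface. At every non-characteristic point of $\mathcal S$ the $H$-mean curvature $$\mathcal H=-\sum_{i=1}^{m-1}\langle\nabla^H_{\boldsymbol e_i}\boldsymbol e_i,\nu^H\rangle$$ coincides with $\sum_{i=1}^mX_i\bar p_i$. In fact, $$\mathcal H=\sum_{i=1}^m\nabla^{H,\mathcal S}_i\langle\nu^H,X_i\rangle=\sum_{i=1}^m\nabla_i^{H,\mathcal S}\bar p_i .$$
   Context: Carnot group: $G$ is a connected, simply connected Lie group whose Lie algebra has a stratification $\mathfrak g=V_1\oplus\dots\oplus V_r$ with $[V_1,V_j]=V_{j+1}$ for $j<r$ and $[V_j,V_r]=0$ for all $j$; $\mathfrak g$ has an inner product for which the $V_j$ are mutually orthogonal. $m=\dim V_1$; $X_1,\dots,X_m$ are the left-invariant fields of an orthonormal basis of $V_1$; $G$ carries the left-invariant Riemannian metric $\langle\cdot,\cdot\rangle$ induced by the inner product, with Levi-Civita connection $\nabla$. The horizontal bundle $HG$ is spanned by $X_1,\dots,X_m$. For horizontal $Y$: $\nabla^H_XY=\sum_{i\le m}\langle\nabla_XY,X_i\rangle X_i$; for functions $\nabla^Hu=\sum_{i\le m}(X_iu)X_i$. Hypersurface: $\boldsymbol N$ is a non-unit Riemannian normal to $\mathcal S$ giving the orientation, locally $\boldsymbol N=\nabla\phi$ with $\phi$ a $C^2$ defining function. $p_i=\langle\boldsymbol N,X_i\rangle$, $W=(\sum_{i\le m}p_i^2)^{1/2}$; characteristic points are those with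 $W=0$; elsewhere $\bar p_i=p_i/W$, $\nu^H=\sum_i\bar p_iX_i$. In the expression $\sum_iX_i\bar p_i$ the $\bar p_i$ are extended to a neighborhood by $\bar p_i=X_i\phi/|\nabla^H\phi|$ (so $\sum\bar p_i^2\equiv1$ there). $\boldsymbol e_1,\dots,\boldsymbol e_{m-1}$ is any local orthonormal frame of $HT\mathcal S$, the bundle with fiber $\{v\in H_gG:\langle v,\nu^H\rangle=0\}$ over non-characteristic points. For $u\in C^1(\mathcal S)$ with $C^1$ extension $\bar u$, $\nabla^{H,\mathcal S}u=\nabla^H\bar u-\langle\nabla^H\bar u,\nu^H\rangle\nu^H=\sum_i(\nabla_i^{H,\mathcal S}u)X_i$. *)

(* Defs.v *)
From HB Require Import structures.
From mathcomp Require Import all_boot all_order all_algebra.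
From mathcomp Require Import all_classical all_reals all_analysis.
Set Implicit Arguments.
Unset Strict Implicit.
Unset Printing Implicit Defensive.
Import Order.TTheory GRing.Theory Num.Theory.
Import numFieldNormedType.Exports.
Local Open Scope classical_set_scope.
Local Open Scope ring_scope.

(* Mere juxtaposition of both structures: the continuity of the group
   operations is part of lieGroup. *)
#[short(type="topGroupType")]
HB.structure Definition TopGroup := {G of Topological G & Group G}.

Section Calculus.
Context {R : realType} {V W : normedModType R}.

(* Meant for open A and finite-dimensional V, where f has a C^k differential
   iff all its directional derivatives are C^k. *)
Fixpoint Ck (k : nat) (A : set V) (f : V -> W) : Prop :=
  match k with
  | 0 => forall x, A x -> {for x, continuous f}
  | k'.+1 => (forall x, A x -> differentiable f x) /\
             forall v, Ck k' A ('D_v f)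
  end.

Definition Csmooth (A : set V) (f : V -> W) : Prop := forall k, Ck k A f.

End Calculus.

(* Together with connectedness (hence, for manifolds, path-connectedness),
   this is simple connectedness. *)
Definition null_homotopic_loops (R : realType) (T : topologicalType) : Prop :=
  forall c : R -> T,
    {within `[0, 1]%classic, continuous c} -> c 0 = c 1 ->
    exists H : R * R -> T,
      [/\ {within (`[0, 1]%classic `*` `[0, 1]%classic), continuous H},
          (forall s, s \in `[0, 1] -> H (s, 0) = c s /\ H (s, 1) = c 0) &
          (forall t, t \in `[0, 1] -> H (0, t) = c 0 /\ H (1, t) = c 0)].

(* The values of chart_map outside chart_dom and of chart_inv outside the
   image of chart_dom are irrelevant. *)
Record chart (R : realType) (n : nat) (G : topologicalType) := Chart {
  chart_dom : set G;
  chart_map : G -> 'rV[R]_n;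
  chart_inv : 'rV[R]_n -> G;
  chart_dom_open : open chart_dom;
  chart_cod_open : open (chart_map @` chart_dom);
  chart_mapK : forall g, chart_dom g -> chart_inv (chart_map g) = g;
  chart_map_continuous :
    forall g, chart_dom g -> {for g, continuous chart_map};
  chart_inv_continuous :
    forall x, (chart_map @` chart_dom) x -> {for x, continuous chart_inv} }.

(* A distinguished chart at the identity identifies T_1 G with 'rV[R]_n. *)
Record lieGroup (R : realType) (n : nat) (G : topGroupType) := LieGroup {
  atlas : set (chart R n G);
  chart1 : chart R n G;
  lie_hausdorff : hausdorff_space G;
  lie_second_countable : @second_countable G;
  atlas_cover : forall g : G, exists2 c, atlas c & chart_dom c g;
  atlas_compat : forall c d, atlas c -> atlas d ->
    Csmooth (chart_map c @` (chart_dom c `&` chart_dom d))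
            (chart_map d \o chart_inv c);
  chart1_atlas : atlas chart1;
  chart1_dom : chart_dom chart1 1%g;
  lie_mul_continuous : continuous (fun p : G * G => (p.1 * p.2)%g);
  lie_inv_continuous : continuous (fun g : G => g^-1%g);
  lie_mul_smooth : forall a b c, atlas a -> atlas b -> atlas c ->
    Csmooth [set p : 'rV[R]_n * 'rV[R]_n |
               [/\ (chart_map a @` chart_dom a) p.1,
                   (chart_map b @` chart_dom b) p.2 &
                   chart_dom c (chart_inv a p.1 * chart_inv b p.2)%g]]
            (fun p => chart_map c (chart_inv a p.1 * chart_inv b p.2)%g);
  lie_inv_smooth : forall a b, atlas a -> atlas b ->
    Csmooth [set x | (chart_map a @` chart_dom a) x /\
                     chart_dom b (chart_inv a x)^-1%g]
            (fun x => chart_map b (chart_inv a x)^-1%g) }.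

Section LieGroups.
Context {R : realType} {n : nat} {G : topGroupType} (L : lieGroup R n G).
Local Notation E := 'rV[R]_n.

Section Regularity.
Context {W : normedModType R}.

Definition Ck_on (k : nat) (O : set G) (u : G -> W) : Prop :=
  forall c, atlas L c ->
    Ck k (chart_map c @` (chart_dom c `&` O)) (u \o chart_inv c).

Definition Ck_near (k : nat) (g : G) (u : G -> W) : Prop :=
  exists2 O, open_nbhs g O & Ck_on k O u.

Definition smooth_near (g : G) (u : G -> W) : Prop :=
  exists2 O, open_nbhs g O & forall k, Ck_on k O u.

End Regularity.

(* The tangent bundle is trivialized by left translations: v : E, seen in
   T_1 G through chart1, stands at g for the vector d(L_g)_1 v of T_g G.
   Hence a vector field is a function G -> E, the left-invariant fields are
   the constant ones, and lder v u is X u for the left-invariant field X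
   with value v at the identity. *)
Definition lder (v : E) (u : G -> R) (g : G) : R :=
  'D_v (fun x : E => u (g * chart_inv (chart1 L) x)%g : R)
    (chart_map (chart1 L) 1%g).

Definition fder (X : G -> E) (u : G -> R) (g : G) : R := lder (X g) u g.

(* The z such that [X, Y] = Z for the left-invariant fields X, Y, Z with
   values v, w, z at the identity. *)
Definition lie_bracket (v w : E) : E :=
  xget 0 [set z | forall (g : G) (u : G -> R), smooth_near g u ->
    lder v (lder w u) g - lder w (lder v u) g = lder z u g].

(* C is the span of the brackets of elements of A and B. *)
Definition bracket_space (A B C : {vspace E}) : Prop :=
  (forall v w, v \in A -> w \in B -> lie_bracket v w \in C) /\
  (forall D : {vspace E},
    (forall v w, v \in A -> w \in B -> lie_bracket v w \in D) ->
    (C <= D)%VS).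

Record stratification (r : nat) (V : nat -> {vspace E}) : Prop := {
  strat_step : (0 < r)%N;
  strat_sum : (\sum_(j < r) V j.+1)%VS = fullv;
  strat_direct : directv (\sum_(j < r) V j.+1);
  strat_gen : forall j, (1 <= j < r)%N -> bracket_space (V 1%N) (V j) (V j.+1);
  strat_nil : forall j v w, (1 <= j <= r)%N ->
    v \in V j -> w \in V r -> lie_bracket v w = 0 }.

Record inner_product (ip : E -> E -> R) : Prop := {
  ip_sym : forall v w, ip v w = ip w v;
  ip_linear : forall (a : R) v w z, ip (a *: v + w) z = a * ip v z + ip w z;
  ip_pos : forall v, v != 0 -> 0 < ip v v }.

Record carnot_group (r : nat) (V : nat -> {vspace E}) (ip : E -> E -> R)
    : Prop := {
  carnot_connected : connected [set: G];
  carnot_simply_connected : null_homotopic_loops R G;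
  carnot_strat : stratification r V;
  carnot_ip : inner_product ip;
  carnot_orthogonal : forall j k v w,
    (1 <= j <= r)%N -> (1 <= k <= r)%N -> j <> k ->
    v \in V j -> w \in V k -> ip v w = 0 }.

Definition orthonormal_basis (ip : E -> E -> R) (U : {vspace E}) (m : nat)
    (b : m.-tuple E) : Prop :=
  basis_of U b /\ forall i j, ip (tnth b i) (tnth b j) = (i == j)%:R.

(* In the left trivialization the left-invariant Riemannian metric is
   <X, Y>(g) = ip (X g) (Y g). For v in T_g G, nabla v Y g is the covariant
   derivative of Y at g in the direction v. Fields and functions are total,
   and the axioms bear on those that are C^1 near the point considered. *)
Record levi_civita (ip : E -> E -> R) (nabla : E -> (G -> E) -> G -> E)
    : Prop := {
  lc_linear : forall g (a : R) v w Y, Ck_near 1 g Y ->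
    nabla (a *: v + w) Y g = a *: nabla v Y g + nabla w Y g;
  lc_add : forall g v Y Z, Ck_near 1 g Y -> Ck_near 1 g Z ->
    nabla v (Y \+ Z) g = nabla v Y g + nabla v Z g;
  lc_leibniz : forall g v (f : G -> R) Y, Ck_near 1 g f -> Ck_near 1 g Y ->
    nabla v (fun h => f h *: Y h) g = lder v f g *: Y g + f g *: nabla v Y g;
  lc_metric : forall g v Y Z, Ck_near 1 g Y -> Ck_near 1 g Z ->
    lder v (fun h => ip (Y h) (Z h)) g =
    ip (nabla v Y g) (Z g) + ip (Y g) (nabla v Z g);
  lc_torsion : forall g X Y (u : G -> R),
    Ck_near 1 g X -> Ck_near 1 g Y -> Ck_near 2 g u ->
    lder (nabla (X g) Y g - nabla (Y g) X g) u g =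
    fder X (fder Y u) g - fder Y (fder X u) g }.

Definition is_gradient (ip : E -> E -> R) (u : G -> R) (g : G) (z : E)
    : Prop :=
  forall v, ip z v = lder v u g.

Definition defining_function (ip : E -> E -> R) (S : set G) (N : G -> E)
    (U : set G) (phi : G -> R) : Prop :=
  [/\ open U, Ck_on 2 U phi, (forall h, U h -> (S h <-> phi h = 0)) &
      forall h, U h -> S h -> N h != 0 /\ is_gradient ip phi h (N h)].

(* N is the (non-unit) normal giving the orientation. Only its values on S
   matter. *)
Definition oriented_hypersurface (ip : E -> E -> R) (S : set G) (N : G -> E)
    : Prop :=
  forall g, S g -> exists U phi, U g /\ defining_function ip S N U phi.

Section Horizontal.
Context (ip : E -> E -> R) {m : nat} (b : m.-tuple E).

Definition hconn (nabla : E -> (G -> E) -> G -> E) (v : E) (Y : G -> E)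
    (g : G) : E :=
  \sum_(i < m) ip (nabla v Y g) (tnth b i) *: tnth b i.

Definition hgrad (u : G -> R) (g : G) : E :=
  \sum_(i < m) lder (tnth b i) u g *: tnth b i.

Section Hypersurface.
Context (S : set G) (N : G -> E).

Definition pcoef (i : 'I_m) (g : G) : R := ip (N g) (tnth b i).

Definition Wnorm (g : G) : R := Num.sqrt (\sum_(i < m) pcoef i g ^+ 2).

Definition noncharacteristic (g : G) : Prop := S g /\ Wnorm g <> 0.

Definition pbar (i : 'I_m) (g : G) : R := pcoef i g / Wnorm g.

Definition nuH (g : G) : E := \sum_(i < m) pbar i g *: tnth b i.

(* The i-th component of the tangential horizontal gradient of a function
   on S, in terms of an extension ub of it off S. *)
Definition hsgrad (i : 'I_m) (ub : G -> R) (g : G) : R :=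
  ip (hgrad ub g - ip (hgrad ub g) (nuH g) *: nuH g) (tnth b i).

Definition C1_extension (g : G) (u ub : G -> R) : Prop :=
  Ck_near 1 g ub /\ \forall h \near g, S h -> ub h = u h.

(* The frame is extended off S by horizontal C^1 fields, as needed to apply
   the connection to it. *)
Record HTS_frame (H : {vspace E}) (g : G) (e : 'I_m.-1 -> G -> E) : Prop := {
  frame_C1 : forall i, Ck_near 1 g (e i);
  frame_horizontal : forall i, \forall h \near g, e i h \in H;
  frame_tangent : forall i,
    \forall h \near g, noncharacteristic h -> ip (e i h) (nuH h) = 0;
  frame_orthonormal : forall i j,
    \forall h \near g, noncharacteristic h ->
      ip (e i h) (e j h) = (i == j)%:R }.

Definition Hmean (nabla : E -> (G -> E) -> G -> E) (e : 'I_m.-1 -> G -> E)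
    (g : G) : R :=
  - \sum_(i < m.-1) ip (hconn nabla (e i g) (e i) g) (nuH g).

End Hypersurface.

(* The extension of pbar off S given by a defining function. *)
Definition pbar_ext (phi : G -> R) (i : 'I_m) (g : G) : R :=
  lder (tnth b i) phi g / Num.sqrt (ip (hgrad phi g) (hgrad phi g)).

End Horizontal.
End LieGroups.

(* Main.v *)
Require Import Defs.
From HB Require Import structures.
From mathcomp Require Import all_boot all_order all_algebra.
From mathcomp Require Import all_classical all_reals all_analysis.
From mathcomp Require Import ring lra.
Import Order.TTheory GRing.Theory Num.Theory.
Import numFieldNormedType.Exports.
Local Open Scope classical_set_scope.
Local Open Scope ring_scope.

(* Extend the components of nu^H by functions u_j near g. Each e_i is tangent
   to S and sum_j u_j <e_i, X_j> vanishes on S, so its derivative along e_i at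
   g is zero; expanding this derivative with the metric property of nabla gives
     - <nabla_{e_i} e_i, nu^H> =
         sum_j <e_i, X_j> e_i(u_j) + sum_j u_j <e_i, nabla_{e_i} X_j>.
   For v, w in V_1 and left-invariant fields, metric compatibility and the
   absence of torsion yield <v, nabla_v w> = <v, [v, w]>, which is zero since
   [v, w] lies in V_2 (or vanishes when r = 1). Hence H is the sum over i, j of
   <e_i, X_j> e_i(u_j), and since the e_i together with nu^H form an orthonormal
   basis of V_1, summing over i produces the tangential gradients of the u_j.
   For the extension by X_j phi / |nabla^H phi| the sum of squares is constant
   near g, which removes the normal contribution. *)

(** * Differentials, and functions vanishing on a level set *)

Section Differentials.
Context {R : realType}.

Lemma near_eq_differentiable (V W : normedModType R) (f g : V -> W) (x : V) :
  (\forall y \near x, f y = g y) -> differentiable f x -> differentiable g x.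
Proof.
move=> fg df.
(* The differential of [f] also gives a first-order expansion of [g] at [x]; by uniqueness it is the
   differential of [g]. *)
have dg : g \o shift x = cst (g x) + 'd f x +o_ 0 id.
  apply/eqaddoP => eps eps0.
  have /eqaddoP /(_ eps eps0) := diff_locally df.
  have : \forall h \near 0, f (h + x) = g (h + x).
    move: fg; rewrite (near_shift 0 x) /=.
    by apply: filterS => h /=; rewrite subr0.
  apply: filterS2 => h fgh.
  rewrite /GRing.add /GRing.opp /= /GRing.add_fun /cst /=.
  by rewrite fgh (nbhs_singleton fg).
have cf : continuous ('d f x) by apply: diff_continuous.
by apply/diff_locallyP; rewrite (diff_unique cf dg).
Qed.

(** In coordinates a linear form is a finite combination of entries. This serves for [ip] with one
    argument fixed, whose linearity is only a property. *)
Lemma differentiable_row_form n (V : normedModType R) (l : 'rV[R]_n -> R)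
    (F : V -> 'rV[R]_n) (x : V) :
  (forall a v w, l (a *: v + w) = a * l v + l w) ->
  differentiable F x -> differentiable (fun y => l (F y)) x.
Proof.
move=> llin dF.
pose lM := GRing.isLinear.Build _ _ _ _ l llin.
pose lL : {linear 'rV[R]_n -> R} := HB.pack l lM.
have lE v : l v = \sum_j v 0 j * l (delta_mx 0 j).
  rewrite -[l]/(lL : _ -> _) {1}(row_sum_delta v) linear_sum.
  by apply: eq_bigr => j _; rewrite linearZ.
have -> : (fun y => l (F y)) =
    \sum_j ((fun y => F y 0 j) * cst (l (delta_mx 0 j))).
  by apply/funext => y; rewrite fct_sumE lE.
apply: differentiable_sum => j; apply: differentiableM => //.
exact: (differentiable_comp dF (differentiable_coord _ _ _)).
Qed.

(** Serves [diff_level_set_eq0] with [c] = |df v|, [K] = |df w|, [D] = dphi w, [a] = |v|, [b] = |w|.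
    First [eps] is taken so that [eps * K] is below [c / 2]; then [eta], the relative error of the
    expansions, is made small against both margins. *)
Lemma small_constants (c K D a b : R) :
    0 < c -> 0 <= K -> 0 < D -> 0 <= a -> 0 <= b ->
  exists eps eta, [/\ 0 < eps, 0 < eta, eta * (a + eps * b + 1) < eps * D &
    eta * (a + eps * b + 1) < c - eps * K].
Proof.
move=> c0 K0 D0 a0 b0; pose eps := c / (2 * (K + 1)).
have eps0 : 0 < eps by rewrite divr_gt0// mulr_gt0// ltr_wpDl.
have epsK : eps * (K + 1) = c / 2 by rewrite /eps; field; lra.
have epsb : 0 <= eps * b by rewrite mulr_ge0// ltW.
have M0 : 0 < a + eps * b + 1 by lra.
have c1 : 0 < c - eps * K by lra.
have d1 : 0 < eps * D by rewrite mulr_gt0.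
pose q := Order.min (eps * D) (c - eps * K).
have q0 : 0 < q by rewrite lt_min d1.
exists eps, (q / (2 * (a + eps * b + 1))).
have -> : q / (2 * (a + eps * b + 1)) * (a + eps * b + 1) = q / 2.
  by field; lra.
have [q1 q2] : q <= eps * D /\ q <= c - eps * K.
  by split; rewrite ge_min lexx ?orbT.
by split=> //; [rewrite divr_gt0// mulr_gt0|lra|lra].
Qed.

(* For small t > 0 the intermediate value theorem yields a zero of phi on the
   segment t (v + s w), |s| <= eps; comparing the first-order expansions of f
   at that zero then bounds the derivative of f along v by a multiple of
   eps. *)
Lemma diff_level_set_eq0 (V : normedModType R) (f phi : V -> R) (x v w : V) :
  differentiable f x -> differentiable phi x ->
  (\forall y \near x, {for y, continuous phi}) -> phi x = 0 ->
  (\forall y \near x, phi y = 0 -> f y = 0) ->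
  'd phi x w != 0 -> 'd phi x v = 0 -> 'd f x v = 0.
Proof.
move=> df dphi cphi phix f0 dw dv.
(* Replacing [w] by [- w] changes the sign of dphi w. *)
wlog dw_gt0 : w dw / 0 < 'd phi x w.
  move=> wl; have [dw0|dw0] := ltP 0 ('d phi x w); first exact: (wl w).
  have dNw : 0 < 'd phi x (- w).
    by rewrite (linearN ('d phi x)) oppr_gt0 lt_neqAle dw.
  by apply: (wl (- w)); rewrite ?gt_eqF.
apply/eqP/negPn/negP => c0; set c := 'd f x v in c0.
have fx : f x = 0 by apply: (nbhs_singleton f0).
have cgt : 0 < `|c| by rewrite normr_gt0.
have [eps [eta [eps0 eta0 eta1 eta2]]] := small_constants _ _ _ _ _
  cgt (normr_ge0 ('d f x w)) dw_gt0 (normr_ge0 v) (normr_ge0 w).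
(* [M] bounds |v + s w| for |s| <= eps; the summand 1 keeps it positive. *)
set M := `|v| + eps * `|w| + 1 in eta1 eta2.
have M0 : 0 < M by rewrite ltr_wpDl// addr_ge0// mulr_ge0// ltW.
have expand (h : V -> R) : differentiable h x -> \forall z \near 0,
    `|h (z + x) - (h x + 'd h x z)| <= eta * `|z|.
  by move=> /diff_locally /eqaddoP /(_ eta eta0).
have shft (P : V -> Prop) : (\forall y \near x, P y) ->
    \forall z \near 0, P (z + x).
  by rewrite (near_shift 0 x); apply: filterS => z /=; rewrite subr0.
have /nbhs_ballP[d /= d0 dP] : \forall z \near (0 : V),
    (`|f (z + x) - (f x + 'd f x z)| <= eta * `|z| /\
     `|phi (z + x) - (phi x + 'd phi x z)| <= eta * `|z|) /\
    ({for z + x, continuous phi} /\ (phi (z + x) = 0 -> f (z + x) = 0)).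
  exact: filterI (filterI (expand f df) (expand phi dphi))
    (filterI (shft _ cphi) (shft _ f0)).
(* Here [t * M = d / 2], so the segment stays in the ball where the expansions hold. *)
pose t := d / (2 * M).
have t0 : 0 < t by rewrite divr_gt0// mulr_gt0.
have tM : t * M < d.
  by rewrite /t invfM mulrA mulfVK ?gt_eqF// gtr_pMr// invf_lt1// ltr1n.
pose z s := t *: (v + s *: w).
have contz : continuous z.
  move=> s; rewrite /z.
  apply: (@continuous_comp R V V (fun s => v + s *: w) ( *:%R t) s).
    by apply: cvgD; [exact: cvg_cst|exact: scalel_continuous].
  exact: scaler_continuous.
have zM s : `|s| <= eps -> `|z s| <= t * M.
  move=> se; rewrite normrZ gtr0_norm// ler_pM2l//.
  apply: (le_trans (ler_normD _ _)); rewrite normrZ /M -addrA lerD2l.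
  by apply: ler_wpDr => //; rewrite ler_wpM2r.
have dz (h : V -> R) s : 'd h x (z s) = t * ('d h x v + s * 'd h x w).
  by rewrite (linearZ_LR ('d h x)) (linearD ('d h x)) (linearZ_LR ('d h x)).
have zP s : `|s| <= eps ->
    [/\ `|f (z s + x) - t * (c + s * 'd f x w)| <= t * (eta * M),
       `|phi (z s + x) - t * (s * 'd phi x w)| <= t * (eta * M),
       {for z s + x, continuous phi} & phi (z s + x) = 0 -> f (z s + x) = 0].
  move=> se; have zs := zM s se.
  have bz : ball 0 d (z s).
    by rewrite -ball_normE /ball_ /= sub0r normrN (le_lt_trans zs).
  have [[h1 h2] [h3 h4]] := dP _ bz.
  have etz : eta * `|z s| <= t * (eta * M) by rewrite mulrCA ler_pM2l.
  split=> //.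
    apply: le_trans etz; move: h1.
    by rewrite fx add0r dz.
  apply: le_trans etz; move: h2.
  by rewrite phix add0r dz dv add0r.
have [|||s] := @IVT R (fun s => phi (z s + x)) (- eps) eps 0.
- by rewrite ge0_cp// ltW.
- apply: continuous_in_subspaceT => s; rewrite inE /= in_itv /= => sI.
  have se : `|s| <= eps by rewrite ler_norml.
  have [_ _ cz _] := zP s se.
  apply: (@continuous_comp _ _ _ (fun s => z s + x) phi) => //.
  by apply: cvgD; [exact: contz|exact: cvg_cst].
(* At [s = eps] and [s = - eps] the term t s dphi(w) outweighs the error t eta M, so phi is
   nonnegative at the first and nonpositive at the second. *)
- have [|_ p1 _ _] := zP eps; first by rewrite gtr0_norm.
  have [|_ p2 _ _] := zP (- eps); first by rewrite normrN gtr0_norm.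
  have tt : t * (eta * M) < t * (eps * 'd phi x w) by rewrite ltr_pM2l.
  rewrite ge_min le_max; apply/andP; split; apply/orP; [left|right].
    move: p2; rewrite ler_distl mulNr mulrN => /andP[_ /le_trans]; apply.
    by rewrite addrC subr_le0 ltW.
  move: p1; rewrite ler_distl => /andP[+ _]; apply: le_trans.
  by rewrite subr_ge0 ltW.
- rewrite in_itv /= => sI phis.
  have se : `|s| <= eps by rewrite ler_norml.
  have [h1 _ _ /(_ phis) fs] := zP s se.
  move: h1; rewrite fs sub0r normrN normrM gtr0_norm// ler_pM2l// => h1.
  (* At the zero of phi, f vanishes too, so its expansion gives |c + s df(w)| <= eta M; this
     contradicts the choice of [eta]. *)
  have : `|c| <= eta * M + eps * `|'d f x w|.
    rewrite -{1}(addrK (s * 'd f x w) c) (le_trans (ler_normB _ _))//.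
    by rewrite lerD// normrM ler_wpM2r.
  by rewrite leNgt -ltrBrDr eta2.
Qed.

End Differentials.

(** * Functions of class C^k between normed spaces *)

Section CkFunctions.
Context {R : realType}.

Lemma Ck_subset (V W : normedModType R) k (A B : set V) (f : V -> W) :
  A `<=` B -> Ck k B f -> Ck k A f.
Proof.
elim: k f => [|k IH] f AB /=; first by move=> h x /AB; exact: h.
by move=> [df Df]; split=> [x /AB|v]; [exact: df|exact: IH].
Qed.

(** On an open set, pointwise equality is equality near each point, hence passes to directional
    derivatives. *)
Lemma eq_Ck (V W : normedModType R) k (A : set V) (f g : V -> W) :
  open A -> (forall x, A x -> f x = g x) -> Ck k A f -> Ck k A g.
Proof.
move=> oA.
have nearE (h h' : V -> W) x : A x -> (forall y, A y -> h y = h' y) ->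
    \forall y \near x, h y = h' y.
  by move=> Ax hh'; apply: filterS (open_nbhs_nbhs (conj oA Ax)).
elim: k f g => [|k IH] f g fg /=.
  move=> cf x Ax.
  have nfg := nearE _ _ _ Ax fg.
  have : f y @[y --> x] --> f x := cf x Ax.
  rewrite /prop_for /continuous_at -(nbhs_singleton nfg).
  by apply: cvg_trans; exact: near_eq_cvg.
move=> [df Df]; split=> [x Ax|v].
  exact: near_eq_differentiable (nearE _ _ _ Ax fg) (df x Ax).
apply: IH (Df v) => x Ax; apply: near_eq_derive; exact: nearE.
Qed.

Lemma Ck_const (V W : normedModType R) k (A : set V) (a : W) :
  Ck k A (fun _ : V => a).
Proof.
elim: k a => [|k IH] a /=; first by move=> x _; exact: cst_continuous.
split=> [x _|v]; first exact: differentiable_cst.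
have -> : 'D_v (fun _ : V => a) = fun _ => 0 :> W.
  by apply/funext => x; rewrite derive_cst.
exact: IH.
Qed.

Lemma differentiable_pairr (U V : normedModType R) (x0 : U) (y : V) :
  differentiable (fun y : V => (x0, y)) y.
Proof. by apply: differentiable_pair => //; exact: differentiable_cst. Qed.

(** Both sides are limits of the same difference quotient. *)
Lemma derive_pairr (U V W : normedModType R) (F : U * V -> W) (x0 : U) (v : V) :
  'D_v (fun y => F (x0, y)) = fun y => 'D_(0, v) F (x0, y).
Proof.
apply/funext => y; apply: (congr1 (fun q : R -> W => lim (q h @[h --> 0^']))).
apply/funext => h /=; congr (_ *: (F _ - _)).
by rewrite /GRing.add /GRing.scale /= /add_pair /scale_pair /= scaler0 add0r.
Qed.

(** Freezing the first variable turns derivatives along [v] into derivatives along [(0, v)]. Applied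
    to the group law, it gives the smoothness of left translations. *)
Lemma Ck_pairr (U V W : normedModType R) k (A : set (U * V)) (F : U * V -> W)
    (x0 : U) :
  Ck k A F -> Ck k [set y | A (x0, y)] (fun y => F (x0, y)).
Proof.
elim: k F => [|k IH] F /=.
  move=> cF y Ay.
  apply: (@continuous_comp _ _ _ (fun y => (x0, y)) F); last exact: cF.
  exact: differentiable_continuous (differentiable_pairr _ _ x0 y).
move=> [dF DF]; split=> [y Ay|v].
  exact: (differentiable_comp (differentiable_pairr _ _ x0 y) (dF _ Ay)).
by rewrite derive_pairr; exact: (IH ('D_(0, v) F)).
Qed.

Lemma derive_coord (V : normedModType R) n (f : V -> 'rV[R]_n) j (x v : V) :
  differentiable f x -> 'D_v (fun x => f x 0 j) x = 'D_v f x 0 j.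
Proof.
move=> df; rewrite derive_mx ?mxE//; exact: diff_derivable.
Qed.

Lemma Ck_coord (V : normedModType R) n k (A : set V) (f : V -> 'rV[R]_n) j :
  open A -> Ck k A f -> Ck k A (fun x => f x 0 j).
Proof.
move=> oA; elim: k f => [|k IH] f /=.
  move=> cf x Ax; apply: (@continuous_comp _ _ _ f (fun M : 'rV_n => M 0 j)).
    exact: cf.
  exact: coord_continuous.
move=> [df Df]; split=> [x Ax|v].
  exact: (differentiable_comp (df x Ax) (differentiable_coord _ _ _)).
apply: eq_Ck (IH ('D_v f) (Df v)) => // x Ax.
by rewrite derive_coord//; exact: df.
Qed.

End CkFunctions.

(** * Left-invariant derivatives on a Lie group *)

Section LieGroupCalculus.
Context {R : realType} {n : nat} {G : topGroupType} (L : lieGroup R n G).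
Local Notation E := 'rV[R]_n.
Local Notation x0 := (chart_map (chart1 L) 1%g).
Local Notation inv1 := (chart_inv (chart1 L)).

(** Inside the open image of the chart, this set is the preimage of [O] under the continuous
    [chart_inv c]. *)
Lemma chart_image_open (c : chart R n G) (O : set G) :
  open O -> open (chart_map c @` (chart_dom c `&` O)).
Proof.
move=> oO; rewrite openE => x [h [ch Oh] <-].
have ncod : nbhs (chart_map c h) (chart_map c @` chart_dom c).
  by apply: open_nbhs_nbhs; split; [exact: chart_cod_open|exists h].
have nO : nbhs (chart_map c h) (chart_inv c @^-1` O).
  apply: (@chart_inv_continuous _ _ _ c); first by exists h.
  by apply: open_nbhs_nbhs; rewrite chart_mapK.
apply: filterS2 ncod nO => y [k ck <-] /=; rewrite chart_mapK// => Ok.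
by exists k.
Qed.

Lemma inv1_x0 : inv1 x0 = 1%g.
Proof. by rewrite chart_mapK//; exact: chart1_dom. Qed.

Lemma mulg_continuous (g : G) : continuous (fun h : G => (g * h)%g).
Proof.
move=> h; apply: (@continuous_comp _ _ _ (fun h => (g, h))
  (fun p : G * G => (p.1 * p.2)%g)); last exact: (lie_mul_continuous L).
by apply: cvg_pair; [exact: cvg_cst|exact: cvg_id].
Qed.

Lemma translate_continuous (g : G) (x : E) :
  (chart_map (chart1 L) @` chart_dom (chart1 L)) x ->
  {for x, continuous (fun x => (g * inv1 x)%g)}.
Proof.
move=> cx; apply: (@continuous_comp _ _ _ inv1 (fun h => (g * h)%g)).
  exact: chart_inv_continuous.
exact: mulg_continuous.
Qed.

Lemma x0_cod : (chart_map (chart1 L) @` chart_dom (chart1 L)) x0.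
Proof. by exists 1%g => //; exact: chart1_dom. Qed.

Lemma near_translate (g : G) (P : set G) :
  nbhs g P -> \forall x \near x0, P (g * inv1 x)%g.
Proof.
move=> gP; apply: (translate_continuous g x0 x0_cod P).
by rewrite inv1_x0 mulg1.
Qed.

Lemma near_chart_dom (g : G) (a : chart R n G) :
  chart_dom a g -> nbhs g (chart_dom a).
Proof.
by move=> ag; apply: open_nbhs_nbhs; split=> //; exact: chart_dom_open.
Qed.

(** Moves calculus at any [g] to the fixed point [x0] of a normed space, where [lder] is an ordinary
    directional derivative. *)
Definition pullback {T : Type} (g : G) (u : G -> T) (x : E) : T :=
  u (g * inv1 x)%g.

Lemma pullback_x0 {T : Type} (g : G) (u : G -> T) : pullback g u x0 = u g.
Proof. by rewrite /pullback inv1_x0 mulg1. Qed.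

Lemma lderE (v : E) (u : G -> R) (g : G) :
  lder L v u g = 'D_v (pullback g u) x0.
Proof. by []. Qed.

(** The group law read in the chart [a] for the left factor and the result, and in [chart1] for the
    right factor. It is the change of coordinates between [pullback] and the chart [a]. *)
Definition mul_map (a : chart R n G) (p : E * E) : E :=
  chart_map a (chart_inv a p.1 * inv1 p.2)%g.

Lemma mul_map_differentiable (a : chart R n G) (h : G) :
  atlas L a -> chart_dom a h ->
  differentiable (mul_map a) (chart_map a h, x0).
Proof.
move=> aL ah; have [+ _] := lie_mul_smooth aL (chart1_atlas L) aL 1%N.
apply; split => /=; [by exists h|exact: x0_cod|].
by rewrite chart_mapK// inv1_x0 mulg1.
Qed.

Lemma mul_map_x0 (a : chart R n G) (h : G) :
  chart_dom a h -> mul_map a (chart_map a h, x0) = chart_map a h.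
Proof. by move=> ah; rewrite /mul_map /= inv1_x0 mulg1 chart_mapK. Qed.

Lemma pullback_chart {T : Type} (a : chart R n G) (h : G) (u : G -> T) :
  chart_dom a h -> \forall y \near x0,
    ((u \o chart_inv a) \o (fun y => mul_map a (chart_map a h, y))) y =
    pullback h u y.
Proof.
move=> ah; near=> y; rewrite /pullback /mul_map /= !chart_mapK//.
by near: y; apply: near_translate; exact: near_chart_dom.
Unshelve. all: by end_near. Qed.

Lemma differentiable_pullback (W : normedModType R) (a : chart R n G) (g : G)
    (u : G -> W) :
  atlas L a -> chart_dom a g ->
  differentiable (u \o chart_inv a) (chart_map a g) ->
  differentiable (pullback g u) x0.
Proof.
move=> aL ag du; apply: near_eq_differentiable (pullback_chart a g u ag) _.
apply: differentiable_comp; last by rewrite mul_map_x0.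
apply: (differentiable_comp (differentiable_pairr _ _ (chart_map a g) x0)).
exact: mul_map_differentiable.
Qed.

Lemma Ck1_differentiable (W : normedModType R) (g : G) (u : G -> W) :
  Ck_near L 1 g u -> differentiable (pullback g u) x0.
Proof.
move=> [ O [_ Og] uO]; have [a aL ag] := atlas_cover L g.
apply: (differentiable_pullback _ a) => //.
by apply: (uO a aL).1; exists g.
Qed.

(** Chain rule through [mul_map a]: in a chart, a left-invariant field is a first-order operator
    with coefficients given by the group law. As [h] varies, this formula can be differentiated
    again. *)
Lemma lder_chart (a : chart R n G) (O : set G) (u : G -> R) (w : E) (h : G) :
  atlas L a -> chart_dom a h -> O h -> Ck_on L 1 O u ->
  lder L w u h = \sum_j 'D_(delta_mx 0 j) (u \o chart_inv a) (chart_map a h)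
    * ('D_(0, w) (mul_map a) (chart_map a h, x0)) 0 j.
Proof.
move=> aL ah Oh uO.
have du : differentiable (u \o chart_inv a) (chart_map a h).
  by apply: (uO a aL).1; exists h.
have dM : differentiable (fun y => mul_map a (chart_map a h, y)) x0.
  apply: (differentiable_comp (differentiable_pairr _ _ (chart_map a h) x0)).
  exact: mul_map_differentiable.
rewrite lderE -(near_eq_derive w (pullback_chart a h u ah)).
have du' : differentiable (u \o chart_inv a) (mul_map a (chart_map a h, x0)).
  by rewrite mul_map_x0.
have dME : 'd (fun y => mul_map a (chart_map a h, y)) x0 w =
    'D_(0, w) (mul_map a) (chart_map a h, x0).
  rewrite -(deriveE w dM).
  exact: (congr1 (@^~ x0) (derive_pairr _ _ _ (mul_map a) (chart_map a h) w)).
rewrite deriveE; last exact: differentiable_comp.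
rewrite diff_comp// /comp dME mul_map_x0//.
rewrite [X in 'd _ _ X = _]row_sum_delta linear_sum.
by apply: eq_bigr => j _; rewrite linearZ/= -deriveE// mulrC.
Qed.

Lemma lder_differentiable (g : G) (u : G -> R) (w : E) :
  Ck_near L 2 g u -> differentiable (pullback g (lder L w u)) x0.
Proof.
move=> [ O [oO Og] uO]; have [a aL ag] := atlas_cover L g.
have u1 : Ck_on L 1 O u.
  move=> c cL; have [d D] := uO c cL; split=> // v x cx.
  by apply: differentiable_continuous; exact: (D v).1.
apply: (differentiable_pullback _ a) => //.
pose F x := \sum_j ('D_(delta_mx 0 j) (u \o chart_inv a) : E -> R) x
    * ('D_(0, w) (mul_map a) (x, x0)) 0 j.
apply: (near_eq_differentiable _ _ F).
  have : nbhs (chart_map a g) (chart_map a @` (chart_dom a `&` O)).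
    by apply: open_nbhs_nbhs; split; [exact: chart_image_open|exists g].
  apply: filterS => x [h [ah Oh] <-].
  by rewrite /F -(lder_chart a O)//= chart_mapK.
have -> : F = \sum_j (('D_(delta_mx 0 j) (u \o chart_inv a) : E -> R) *
    (fun x => ('D_(0, w) (mul_map a) (x, x0)) 0 j)).
  by apply/funext => x; rewrite fct_sumE.
apply: differentiable_sum => j; apply: differentiableM.
  by have [_ /(_ (delta_mx 0 j))[+ _]] := uO a aL; apply; exists g.
apply: (@differentiable_comp _ _ _ _ (fun x => 'D_(0, w) (mul_map a) (x, x0))
  (fun M : E => M 0 j)); last exact: differentiable_coord.
apply: (@differentiable_comp _ _ _ _ (fun x : E => (x, x0))
  ('D_(0, w) (mul_map a))).
  by apply: differentiable_pair => //; exact: differentiable_cst.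
(* Order 2 is needed of the group law because its derivative along [(0, w)] is itself
   differentiated. *)
have [_ /(_ (0, w))[+ _]] := lie_mul_smooth aL (chart1_atlas L) aL 2%N.
apply; split => /=; [by exists g|exact: x0_cod|].
by rewrite chart_mapK// inv1_x0 mulg1.
Qed.

Lemma lder_sum (I : finType) (g : G) (u : G -> R) (a : I -> R) (v : I -> E) :
  differentiable (pullback g u) x0 ->
  lder L (\sum_i a i *: v i) u g = \sum_i a i * lder L (v i) u g.
Proof.
move=> du; rewrite lderE deriveE// linear_sum; apply: eq_bigr => i _.
by rewrite linearZ /= lderE deriveE.
Qed.

(** Left invariance is associativity of the product. *)
Lemma lder_translate (v : E) (u : G -> R) (g h : G) :
  lder L v (fun k => u (g * k)%g) h = lder L v u (g * h)%g.
Proof.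
rewrite !lderE; congr ('D_v _ _).
by apply/funext => x; rewrite /pullback mulgA.
Qed.

(** Chart coordinates carried to [g] by left translation, used as test functions that determine a
    tangent vector at [g]. *)
Definition coord_at (g : G) (j : 'I_n) (h : G) : R :=
  chart_map (chart1 L) (g^-1 * h)%g 0 j.

Lemma coord_at_smooth (g : G) (j : 'I_n) : smooth_near L g (coord_at g j).
Proof.
pose O := (fun h => (g^-1 * h)%g) @^-1` chart_dom (chart1 L).
have oO : open O.
  apply: open_comp; last exact: chart_dom_open.
  by move=> h _; exact: mulg_continuous.
exists O.
  by split=> //; rewrite /O /= mulVg; exact: chart1_dom.
(* With a chart around [g^-1], the translation by [g^-1] becomes the group law with its first
   argument frozen. *)
move=> k c cL; have [a aL ag] := atlas_cover L g^-1%g.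
pose M (p : E * E) :=
  chart_map (chart1 L) (chart_inv a p.1 * chart_inv c p.2)%g.
have -> : coord_at g j \o chart_inv c = fun x => M (chart_map a g^-1%g, x) 0 j.
  by apply/funext => x; rewrite /M /coord_at /= chart_mapK.
apply: (Ck_coord _ _ _ _ (fun x => M (chart_map a g^-1%g, x))).
  exact: chart_image_open.
have := Ck_pairr _ _ _ k _ M (chart_map a g^-1%g)
  (lie_mul_smooth aL cL (chart1_atlas L) k).
apply: Ck_subset => x [h [ch Oh] <-] /=; rewrite !chart_mapK//.
by split => //; [exists g^-1%g|exists h].
Qed.

Lemma lder_coord_at (g : G) (j : 'I_n) (z : E) :
  lder L z (coord_at g j) g = z 0 j.
Proof.
have dc : {near x0, (fun x : E => x 0 j) =1 pullback g (coord_at g j)}.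
  have : nbhs x0 (chart_map (chart1 L) @` chart_dom (chart1 L)).
    by apply: open_nbhs_nbhs; split; [exact: chart_cod_open|exact: x0_cod].
  apply: filterS => _ [h ch <-].
  by rewrite /pullback /coord_at mulKg chart_mapK.
by rewrite lderE -(near_eq_derive z dc) derive_coord// derive_id.
Qed.

(** [coord_at 1] is a left translate of [coord_at g], and left-invariant derivatives commute with
    left translations. *)
Lemma lder2_coord_at (g : G) (j : 'I_n) (v w : E) :
  lder L v (lder L w (coord_at g j)) g =
  lder L v (lder L w (coord_at 1%g j)) 1%g.
Proof.
have cE : coord_at 1%g j = fun k => coord_at g j (g * k)%g.
  by apply/funext => k; rewrite /coord_at mulKg invg1 mul1g.
rewrite cE.
have -> : lder L w (fun k => coord_at g j (g * k)%g) =
    fun k => lder L w (coord_at g j) (g * k)%g.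
  by apply/funext => k; rewrite lder_translate.
by rewrite lder_translate mulg1.
Qed.

Lemma Ck_near_const (W : normedModType R) k (g : G) (a : W) :
  Ck_near L k g (fun _ => a).
Proof.
exists setT; first by split=> //; exact: openT.
by move=> c cL; exact: Ck_const.
Qed.

(* Testing the torsion identity on left translates of chart coordinates shows
   that the torsion of two left-invariant fields is itself left-invariant. *)
Lemma lie_bracketE (ip : E -> E -> R) (nabla : E -> (G -> E) -> G -> E)
    (v w : E) (g : G) : levi_civita L ip nabla ->
  lie_bracket L v w = nabla v (fun _ => w) g - nabla w (fun _ => v) g.
Proof.
move=> lc; pose z h := nabla v (fun _ => w) h - nabla w (fun _ => v) h.
have zE h u : Ck_near L 2 h u ->
    lder L v (lder L w u) h - lder L w (lder L v u) h = lder L (z h) u h.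
  move=> u2; rewrite /z.
  by rewrite (lc_torsion lc (Ck_near_const E 1 h v) (Ck_near_const E 1 h w) u2).
have coord_C2 h j : Ck_near L 2 h (coord_at h j).
  by have [ O Oh uO] := coord_at_smooth h j; exists O.
have zj h j : z h 0 j = lder L v (lder L w (coord_at h j)) h -
    lder L w (lder L v (coord_at h j)) h.
  by rewrite (zE _ _ (coord_C2 h j)) lder_coord_at.
have zc h : z h = z 1%g.
  by apply/rowP => j; rewrite !zj (lder2_coord_at h) (lder2_coord_at h j w).
(* The torsion at 1 belongs to the set that defines [lie_bracket], so [xget] returns an element of
   this set; testing on coordinates then identifies it. *)
have bP := xgetPex 0 (ex_intro [set z' | forall (h : G) (u : G -> R),
  smooth_near L h u ->
  lder L v (lder L w u) h - lder L w (lder L v u) h = lder L z' u h] (z 1%g) _).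
rewrite -/(z g) zc; apply/rowP => j; rewrite zj -[LHS](lder_coord_at 1%g).
rewrite /lie_bracket -bP//; last exact: coord_at_smooth.
move=> h u [ O Oh uO]; rewrite -(zc h) zE//; by exists O.
Qed.

End LieGroupCalculus.

(** * Inner products and orthonormal bases *)

Section InnerProduct.
Context {R : realType} {n : nat} (ip : 'rV[R]_n -> 'rV[R]_n -> R).
Hypothesis ipP : inner_product ip.
Local Notation E := 'rV[R]_n.

Lemma ipDl (v w z : E) : ip (v + w) z = ip v z + ip w z.
Proof. by have := ip_linear ipP 1 v w z; rewrite scale1r mul1r. Qed.

Lemma ip0l (z : E) : ip 0 z = 0.
Proof. by apply: (addrI (ip 0 z)); rewrite -ipDl !addr0. Qed.

Lemma ipZl (a : R) (v z : E) : ip (a *: v) z = a * ip v z.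
Proof. by have := ip_linear ipP a v 0 z; rewrite ip0l !addr0. Qed.

Lemma ip_suml (I : finType) (a : I -> R) (v : I -> E) (z : E) :
  ip (\sum_i a i *: v i) z = \sum_i a i * ip (v i) z.
Proof.
rewrite (big_morph (fun v => ip v z) (fun v w => ipDl v w z) (ip0l z)).
by apply: eq_bigr => i _; rewrite ipZl.
Qed.

Lemma ip_sumr (I : finType) (a : I -> R) (v : I -> E) (z : E) :
  ip z (\sum_i a i *: v i) = \sum_i a i * ip z (v i).
Proof.
rewrite (ip_sym ipP) ip_suml; apply: eq_bigr => i _.
by rewrite (ip_sym ipP).
Qed.

Section OrthonormalBasis.
Context {m : nat} {b : m.-tuple E}.
Hypothesis b_on : forall i j, ip (tnth b i) (tnth b j) = (i == j)%:R.

Lemma ip_lincomb (a : 'I_m -> R) (j : 'I_m) :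
  ip (\sum_i a i *: tnth b i) (tnth b j) = a j.
Proof.
rewrite ip_suml (bigD1 j)//= big1 => [|i ij]; rewrite b_on.
  by rewrite eqxx mulr1 addr0.
by rewrite (negPf ij) mulr0.
Qed.

Lemma ip_lincomb2 (a c : 'I_m -> R) :
  ip (\sum_i a i *: tnth b i) (\sum_i c i *: tnth b i) = \sum_i a i * c i.
Proof.
rewrite ip_sumr; apply: eq_bigr => i _.
by rewrite ip_lincomb mulrC.
Qed.

Lemma orthonormal_expand (U : {vspace E}) (v : E) :
  basis_of U b -> v \in U -> v = \sum_i ip v (tnth b i) *: tnth b i.
Proof.
move=> bU vU; have vE : v = \sum_i coord b i v *: tnth b i.
  rewrite {1}(coord_basis bU vU); apply: eq_bigr => i _.
  by rewrite (tnth_nth 0).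
by rewrite {1}vE; apply: eq_bigr => i _; rewrite {2}vE ip_lincomb.
Qed.

End OrthonormalBasis.
End InnerProduct.

(** The rows of [a] completed by [p] make a square matrix with orthonormal rows. Its columns are
    then orthonormal too, a right inverse of a square matrix being a left inverse. *)
Lemma orthonormal_columns (R : realType) (m : nat) (a : 'I_m.-1 -> 'I_m -> R)
    (p : 'I_m -> R) :
  (forall i i', \sum_j a i j * a i' j = (i == i')%:R) ->
  (forall i, \sum_j a i j * p j = 0) -> \sum_j p j * p j = 1 ->
  forall j k, \sum_i a i j * a i k = (j == k)%:R - p j * p k.
Proof.
case: m a p => [|m] a p aa ap pp j k; first by case: j.
pose A := \matrix_(i, j) if unlift ord0 i is Some i' then a i' j else p j.
have A0 l : A ord0 l = p l by rewrite mxE unlift_none.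
have AS (i : 'I_m) l : A (lift ord0 i) l = a i l by rewrite mxE liftK.
have : A *m A^T = 1%:M.
  apply/matrixP => i i'; rewrite !mxE.
  under eq_bigr do rewrite [A^T _ _]mxE.
  case: (unliftP ord0 i) => [i1|] ->; case: (unliftP ord0 i') => [i2|] ->.
  - by under eq_bigr do rewrite !AS; rewrite aa (inj_eq lift_inj).
  - by under eq_bigr do rewrite AS A0; rewrite ap.
  - under eq_bigr do rewrite AS A0 mulrC.
    by rewrite ap.
  - by under eq_bigr do rewrite A0; rewrite pp eqxx.
move=> /mulmx1C /matrixP /(_ j k); rewrite !mxE big_ord_recl mxE !A0 => <-.
rewrite [RHS]addrC addKr; apply: eq_bigr => i _.
by rewrite mxE !AS.
Qed.

(** * Continuity and derivation rules for functions on G *)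

Section MeanCurvature.
Context {R : realType} {n : nat} {G : topGroupType} {L : lieGroup R n G}.
Local Notation E := 'rV[R]_n.
Local Notation x0 := (chart_map (chart1 L) 1%g).

Lemma Ck_on_continuous (B : set G) (u : G -> R) (h : G) :
  Ck_on L 1 B u -> B h -> {for h, continuous u}.
Proof.
move=> uB Bh; have [a aL ah] := atlas_cover L h.
have cu : {for chart_map a h, continuous (u \o chart_inv a)}.
  by apply: differentiable_continuous; apply: (uB a aL).1; exists h.
have := continuous_comp (chart_map_continuous ah) cu.
rewrite /prop_for /continuous_at /= chart_mapK//; apply: cvg_trans.
apply: near_eq_cvg; apply: filterS (near_chart_dom _ _ ah) => k ak.
by rewrite /= chart_mapK.
Qed.

Lemma pullback_continuous (g : G) (u : G -> R) (x : E) :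
  (chart_map (chart1 L) @` chart_dom (chart1 L)) x ->
  {for (g * chart_inv (chart1 L) x)%g, continuous u} ->
  {for x, continuous (pullback L g u)}.
Proof.
move=> cx cu; apply: (@continuous_comp _ _ _
  (fun x => (g * chart_inv (chart1 L) x)%g) u) cu.
exact: translate_continuous.
Qed.

Lemma lderM (v : E) (u u' : G -> R) (g : G) :
  differentiable (pullback L g u) x0 -> differentiable (pullback L g u') x0 ->
  lder L v (fun h => u h * u' h) g = lder L v u g * u' g + u g * lder L v u' g.
Proof.
move=> du du'.
rewrite lderE (_ : pullback _ _ _ = pullback L g u * pullback L g u')//.
rewrite deriveM; [|exact: diff_derivable|exact: diff_derivable].
by rewrite !pullback_x0 addrC mulrC.
Qed.

Lemma lder_big (k : nat) (v : E) (u : 'I_k -> G -> R) (g : G) :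
  (forall i, differentiable (pullback L g (u i)) x0) ->
  lder L v (fun h => \sum_i u i h) g = \sum_i lder L v (u i) g.
Proof.
move=> du.
rewrite lderE (_ : pullback _ _ _ = \sum_i pullback L g (u i)).
  by rewrite derive_sum// => i; exact: diff_derivable.
by apply/funext => x; rewrite fct_sumE.
Qed.

Lemma differentiable_sqrt (W : normedModType R) (u : W -> R) (x : W) :
  differentiable u x -> 0 < u x -> differentiable (fun y => Num.sqrt (u y)) x.
Proof.
move=> du ux; apply: (@differentiable_comp _ _ _ _ u Num.sqrt) => //.
by apply/derivable1_diffP; have [] := is_derive1_sqrt ux.
Qed.

(** * The connection on horizontal left-invariant fields *)

Section Carnot.
Context {r : nat} {V : nat -> {vspace E}} {ip : E -> E -> R}.
Context {nabla : E -> (G -> E) -> G -> E}.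
Hypothesis GV : carnot_group L r V ip.
Hypothesis lc : levi_civita L ip nabla.
Let ipP := carnot_ip GV.

Lemma ip_lie_bracket_horizontal (v w z : E) :
  v \in V 1%N -> w \in V 1%N -> z \in V 1%N -> ip z (lie_bracket L v w) = 0.
Proof.
move=> vV wV zV; have st := carnot_strat GV.
have r0 := strat_step st.
have [r1|r1] := leqP r 1.
  have rE : r = 1%N by apply/eqP; rewrite eqn_leq r1.
  have -> : lie_bracket L v w = 0.
    by apply: (strat_nil st (j := 1%N)); rewrite ?rE.
  by rewrite (ip_sym ipP) (ip0l _ ipP).
have [+ _] := strat_gen st (j := 1%N) r1.
move=> /(_ v w vV wV) bV2.
by apply: (carnot_orthogonal GV (j := 1%N) (k := 2%N)) => //; rewrite r1.
Qed.

Lemma nabla_left_invariant_orth (v w : E) (g : G) :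
  v \in V 1%N -> w \in V 1%N -> ip v (nabla v (fun _ => w) g) = 0.
Proof.
move=> vV wV.
have -> : nabla v (fun _ => w) g =
    1 *: lie_bracket L v w + nabla w (fun _ => v) g.
  by rewrite (lie_bracketE L ip nabla v w g lc) scale1r subrK.
rewrite (ip_sym ipP) (ip_linear ipP) mul1r (ip_sym ipP).
rewrite ip_lie_bracket_horizontal// add0r.
have vC : Ck_near L 1 g (fun _ : G => v) by exact: Ck_near_const.
(* What remains is <v, nabla_w v>, half the derivative along [w] of the constant <v, v>. *)
have := lc_metric lc w vC vC.
rewrite lderE (_ : pullback _ _ _ = fun _ => ip v v)// derive_cst.
rewrite (ip_sym ipP v) => /eqP; rewrite eq_sym -mulr2n mulrn_eq0 /=.
by move/eqP.
Qed.

(** * The horizontal normal and its unit extension off S *)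

Context {m : nat} {b : m.-tuple E}.
Hypothesis hb : orthonormal_basis ip (V 1%N) b.
Context {S : set G} {N : G -> E} {g : G}.
Hypothesis hg : noncharacteristic ip b S N g.
Context {U : set G} {phi : G -> R}.
Hypothesis hU : U g.
Hypothesis hphi : defining_function L ip S N U phi.
Let b_on := hb.2.

Let phi_C2 : Ck_near L 2 g phi.
Proof. by have [oU phiU _ _] := hphi; exists U. Qed.

Let dphi_differentiable j :
  differentiable (pullback L g (lder L (tnth b j) phi)) x0.
Proof. exact: lder_differentiable. Qed.

(** On S near [g] this is the square of W; unlike W, it is governed by phi off S as well. *)
Let normsq (h : G) := \sum_j lder L (tnth b j) phi h ^+ 2.

Let normsq_differentiable : differentiable (pullback L g normsq) x0.
Proof.
have -> : pullback L g normsq =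
    \sum_j (pullback L g (lder L (tnth b j) phi) ^+ 2).
  by apply/funext => x; rewrite fct_sumE.
by apply: differentiable_sum => j; exact: differentiableX.
Qed.

Lemma pcoefE j h : U h -> S h -> pcoef ip b N j h = lder L (tnth b j) phi h.
Proof. by have [_ _ _ +] := hphi => /[apply] /[apply] -[_]; exact. Qed.

Lemma WnormE h : U h -> S h -> Wnorm ip b N h = Num.sqrt (normsq h).
Proof.
move=> Uh Sh; congr (Num.sqrt _); apply: eq_bigr => j _.
by rewrite pcoefE.
Qed.

Lemma pbar_extE j h : pbar_ext L ip b phi j h =
  lder L (tnth b j) phi h / Num.sqrt (normsq h).
Proof. by rewrite /pbar_ext /hgrad (ip_lincomb2 _ ipP b_on). Qed.

Lemma pbar_ext_pbar j h : U h -> S h ->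
  pbar_ext L ip b phi j h = pbar ip b N j h.
Proof. by move=> Uh Sh; rewrite pbar_extE /pbar pcoefE// WnormE. Qed.

Let Sg : S g. Proof. by case: hg. Qed.

Let normsq_gt0 : 0 < normsq g.
Proof.
have [_] := hg; rewrite WnormE// => /eqP.
by rewrite sqrtr_eq0 -ltNge.
Qed.

Let near_normsq_gt0 :
  \forall x \near x0, 0 < pullback L g normsq x.
Proof.
have := differentiable_continuous normsq_differentiable.
move=> /(_ [set y | 0 < y]); apply; rewrite pullback_x0.
by apply: open_nbhs_nbhs; split => //; exact: open_gt.
Qed.

Lemma pbar_ext_differentiable j :
  differentiable (pullback L g (pbar_ext L ip b phi j)) x0.
Proof.
have -> : pullback L g (pbar_ext L ip b phi j) =
    pullback L g (lder L (tnth b j) phi) *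
    (fun x => (Num.sqrt (pullback L g normsq x))^-1).
  by apply/funext => x; rewrite /pullback pbar_extE.
apply: differentiableM => //.
apply: (@differentiableV _ _ (fun x => Num.sqrt (pullback L g normsq x))).
  by apply: differentiable_sqrt => //; rewrite pullback_x0.
by rewrite pullback_x0 gt_eqF// sqrtr_gt0.
Qed.

Lemma near_pbar_ext_unit : \forall x \near x0,
  \sum_j pullback L g (pbar_ext L ip b phi j) x ^+ 2 = 1.
Proof.
apply: filterS near_normsq_gt0 => x q0.
under eq_bigr do rewrite /pullback pbar_extE expr_div_n.
rewrite -mulr_suml sqr_sqrtr; last exact: ltW.
by rewrite divff// gt_eqF.
Qed.

Lemma pbar_unit : \sum_j pbar ip b N j g * pbar ip b N j g = 1.
Proof.
rewrite -[RHS](nbhs_singleton near_pbar_ext_unit).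
by apply: eq_bigr => j _; rewrite pullback_x0 pbar_ext_pbar.
Qed.

(** * The tangent frame at [g] *)

Context {e : 'I_m.-1 -> G -> E}.
Hypothesis he : HTS_frame L ip b S N (V 1%N) g e.
Let a i j := ip (e i g) (tnth b j).
Let p j := pbar ip b N j g.

Let e_horizontal i : e i g \in V 1%N.
Proof. exact: (nbhs_singleton (frame_horizontal he i)). Qed.

Let e_expand i : e i g = \sum_j a i j *: tnth b j.
Proof. exact: (orthonormal_expand _ ipP b_on _ _ hb.1 (e_horizontal i)). Qed.

Lemma frame_orth_pbar i : \sum_j a i j * p j = 0.
Proof.
rewrite -[RHS](nbhs_singleton (frame_tangent he i) hg) /nuH (ip_sumr _ ipP).
by apply: eq_bigr => j _; rewrite mulrC.
Qed.

(** The frame and nu^H form an orthonormal basis of V_1, so summing over the frame gives the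
    projection orthogonal to nu^H. *)
Lemma frame_completeness j k :
  \sum_i a i j * a i k = (j == k)%:R - p j * p k.
Proof.
apply: orthonormal_columns; [|exact: frame_orth_pbar|exact: pbar_unit].
move=> i i'; rewrite -(nbhs_singleton (frame_orthonormal he i i') hg).
by rewrite (e_expand i) (e_expand i') (ip_lincomb2 _ ipP b_on).
Qed.

(** The horizontal part of N is W nu^H, and [e i g] is horizontal and orthogonal to nu^H. *)
Lemma frame_tangent_phi i : lder L (e i g) phi g = 0.
Proof.
have [_ _ _ /(_ g hU Sg)[_ <-]] := hphi.
rewrite e_expand (ip_sumr _ ipP).
have [_ /eqP W0] := hg.
apply: (mulIf (invr_neq0 W0)); rewrite mul0r -[RHS](frame_orth_pbar i).
by rewrite mulr_suml; apply: eq_bigr => j _; rewrite -mulrA.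
Qed.

(** Supplies the transverse direction for [diff_level_set_eq0]; it exists because [g] is
    non-characteristic. *)
Lemma phi_transverse : exists j, lder L (tnth b j) phi g != 0.
Proof.
apply/existsP; apply: contraLR normsq_gt0 => /existsPn d0.
rewrite -leNgt /normsq big1// => j _.
by move: (d0 j); rewrite negbK => /eqP ->; rewrite expr0n.
Qed.

Let ip_frame_differentiable i j :
  differentiable (pullback L g (fun h => ip (e i h) (tnth b j))) x0.
Proof.
apply: (differentiable_row_form _ _ (fun v => ip v (tnth b j))
  (pullback L g (e i))).
  by move=> c v w; exact: (ip_linear ipP).
apply: Ck1_differentiable; exact: (frame_C1 he).
Qed.

(** * Mean curvature through an extension of nu^H *)

Section Extension.
Context {ub : 'I_m -> G -> R}.
Hypothesis ub_differentiable :
  forall j, differentiable (pullback L g (ub j)) x0.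
Hypothesis ub_ext :
  forall j, \forall h \near g, S h -> ub j h = pbar ip b N j h.

(* The function differentiated here is <e_i, nu^H>, which vanishes on S only;
   e_i being tangent to S, this is enough. *)
Lemma lder_frame_normal i :
  lder L (e i g) (fun h => \sum_j ub j h * ip (e i h) (tnth b j)) g = 0.
Proof.
set f := fun h => _.
have df : differentiable (pullback L g f) x0.
  have -> : pullback L g f = \sum_j (pullback L g (ub j) *
      pullback L g (fun h => ip (e i h) (tnth b j))).
    by apply/funext => x; rewrite fct_sumE.
  by apply: differentiable_sum => j; exact: differentiableM.
have dphi : differentiable (pullback L g phi) x0.
  apply: Ck1_differentiable; have [ O Og phiO] := phi_C2; exists O => // c cL.
  have [d D] := phiO c cL; split=> // v x cx.
  by apply: differentiable_continuous; exact: (D v).1.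
have [oU phiU SU _] := hphi.
have nU : nbhs g U by exact: open_nbhs_nbhs.
have [j dj] := phi_transverse.
rewrite lderE deriveE//.
apply: (diff_level_set_eq0 _ _ (pullback L g phi) _ _ (tnth b j)) => //.
- have ncod : nbhs x0 (chart_map (chart1 L) @` chart_dom (chart1 L)).
    by apply: open_nbhs_nbhs; split; [exact: chart_cod_open|exact: x0_cod].
  apply: filterS2 ncod (near_translate L _ _ nU) => x cx Ux.
  apply: pullback_continuous => //; apply: (Ck_on_continuous U) => //.
  move=> c cL; have [d D] := phiU c cL; split=> // v y cy.
  by apply: differentiable_continuous; exact: (D v).1.
- by rewrite pullback_x0; apply/SU.
- have nub : nbhs g [set h | forall j, S h -> ub j h = pbar ip b N j h].
    by apply: filter_forall.
  near=> x.
  have : 0 < pullback L g normsq x by near: x; exact: near_normsq_gt0.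
  have : U (g * chart_inv (chart1 L) x)%g.
    by near: x; exact: (near_translate L _ _ nU).
  have : forall k, S (g * chart_inv (chart1 L) x)%g ->
      ub k (g * chart_inv (chart1 L) x)%g =
      pbar ip b N k (g * chart_inv (chart1 L) x)%g.
    by near: x; exact: (near_translate L _ _ nub).
  have : noncharacteristic ip b S N (g * chart_inv (chart1 L) x)%g ->
      ip (e i (g * chart_inv (chart1 L) x)%g)
         (nuH ip b N (g * chart_inv (chart1 L) x)%g) = 0.
    by near: x; exact: (near_translate L _ _ (frame_tangent he i)).
  rewrite /pullback; set h := (g * chart_inv (chart1 L) x)%g => th ubh Uh q0.
  move=> /(SU _ Uh) Sh.
  (* Tangency of the frame is known at non-characteristic points only; points of S near [g] are
     such, [normsq] being positive there. *)
  have /th : noncharacteristic ip b S N h.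
    by split=> //; rewrite WnormE//; apply/eqP; rewrite gt_eqF// sqrtr_gt0.
  rewrite /nuH (ip_sumr _ ipP) => tE; rewrite -[RHS]tE.
  by apply: eq_bigr => k _; rewrite ubh.
- by rewrite -deriveE// -lderE.
- by rewrite -deriveE// -lderE frame_tangent_phi.
Unshelve. all: by end_near. Qed.

Lemma ub_g j : ub j g = p j.
Proof. exact: (nbhs_singleton (ub_ext j)). Qed.

Lemma hconn_frame i :
  ip (hconn ip b nabla (e i g) (e i) g) (nuH ip b N g) =
  - \sum_j lder L (e i g) (ub j) g * a i j.
Proof.
apply/eqP; rewrite -addr_eq0 addrC; apply/eqP.
rewrite -[RHS](lder_frame_normal i) lder_big; last first.
  move=> j; apply: (@differentiableM _ _ (pullback L g (ub j))
    (pullback L g (fun h => ip (e i h) (tnth b j)))) => //.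
rewrite /hconn /nuH (ip_lincomb2 _ ipP b_on) -big_split /=.
apply: eq_bigr => j _; rewrite lderM// ub_g; congr (_ + _).
have bC1 := Ck_near_const L E 1 g (tnth b j).
rewrite (lc_metric lc (e i g) (frame_C1 he i) bC1).
(* The term <e_i, nabla_{e_i} X_j> involves [e i] only through its value at [g], which can be read
   as a left-invariant field. *)
rewrite nabla_left_invariant_orth ?addr0 1?mulrC//.
by apply: (basis_mem hb.1); exact: mem_tnth.
Qed.

Lemma hsgradE j : hsgrad L ip b N j (ub j) g =
  lder L (tnth b j) (ub j) g
  - \sum_k p j * p k * lder L (tnth b k) (ub j) g.
Proof.
rewrite /hsgrad -scaleN1r addrC scalerA (ip_linear ipP) /hgrad /nuH.
rewrite !(ip_lincomb _ ipP b_on) (ip_lincomb2 _ ipP b_on) addrC; congr (_ + _).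
rewrite mulN1r mulNr; congr (- _); rewrite mulr_suml; apply: eq_bigr => k _.
by rewrite mulrC -/(p k) -/(p j); ring.
Qed.

(** The extension is only differentiable at [g], so that the result covers both C^1 extensions and
    [pbar_ext]. *)
Lemma Hmean_extension :
  Hmean ip b N nabla e g = \sum_j hsgrad L ip b N j (ub j) g.
Proof.
rewrite /Hmean; under eq_bigr do rewrite hconn_frame.
rewrite sumrN opprK exchange_big /=; apply: eq_bigr => j _.
rewrite hsgradE.
under eq_bigr => i _.
  rewrite (e_expand i) lder_sum// mulr_suml; over.
rewrite exchange_big /=.
(* The Kronecker sum lets [frame_completeness] match the two sides term by term. *)
have -> : lder L (tnth b j) (ub j) g =
    \sum_k (j == k)%:R * lder L (tnth b k) (ub j) g.
  rewrite (bigD1 j)//= eqxx mul1r big1 ?addr0// => k kj.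
  by rewrite eq_sym (negPf kj) mul0r.
rewrite -sumrB; apply: eq_bigr => k _.
rewrite -mulrBl -frame_completeness mulr_suml; apply: eq_bigr => i _.
by rewrite mulrC mulrA.
Qed.

End Extension.

(* The normal part of the tangential gradients of the components of the unit
   extension is half the derivative of their sum of squares, i.e. of 1. *)
Lemma sum_hsgrad_pbar_ext :
  \sum_j hsgrad L ip b N j (pbar_ext L ip b phi j) g =
  \sum_j lder L (tnth b j) (pbar_ext L ip b phi j) g.
Proof.
pose pe := pbar_ext L ip b phi.
have peg j : pe j g = p j by exact: pbar_ext_pbar.
have unit_der k : \sum_j p j * lder L (tnth b k) (pe j) g = 0.
  have : lder L (tnth b k) (fun h => \sum_j pe j h * pe j h) g = 0.
    have sq1 : {near x0, (fun _ : E => 1 : R) =1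
        pullback L g (fun h => \sum_j pe j h * pe j h)}.
      apply: filterS near_pbar_ext_unit => x <-.
      by apply: eq_bigr => j _; rewrite expr2.
    by rewrite lderE -(near_eq_derive _ sq1) derive_cst.
  rewrite lder_big; last first.
    move=> j; apply: (@differentiableM _ _ (pullback L g (pe j))
      (pullback L g (pe j))); exact: pbar_ext_differentiable.
  have sq_der j : lder L (tnth b k) (fun h => pe j h * pe j h) g =
      (p j * lder L (tnth b k) (pe j) g) *+ 2.
    by rewrite lderM ?peg 1?mulrC -?mulr2n//; exact: pbar_ext_differentiable.
  under eq_bigr do rewrite sq_der.
  by rewrite sumrMnl => /eqP; rewrite mulrn_eq0 /= => /eqP.
under eq_bigr do rewrite hsgradE.
rewrite sumrB exchange_big /= [X in _ - X]big1 ?subr0// => k _.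
rewrite -[RHS](mulr0 (p k)) -[in RHS](unit_der k) mulr_sumr.
apply: eq_bigr => j _. by rewrite -mulrA [RHS]mulrCA.
Qed.

End Carnot.
End MeanCurvature.

Theorem proposition9p9 (R : realType) (n : nat) (G : topGroupType)
    (L : lieGroup R n G) (r : nat) (V : nat -> {vspace 'rV[R]_n})
    (ip : 'rV[R]_n -> 'rV[R]_n -> R) (hG : carnot_group L r V ip)
    (m : nat) (b : m.-tuple 'rV[R]_n) (hb : orthonormal_basis ip (V 1%N) b)
    (nabla : 'rV[R]_n -> (G -> 'rV[R]_n) -> G -> 'rV[R]_n)
    (hnabla : levi_civita L ip nabla)
    (S : set G) (N : G -> 'rV[R]_n) (hS : oriented_hypersurface L ip S N)
    (g : G) (hg : noncharacteristic ip b S N g)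
    (U : set G) (phi : G -> R) (hU : U g)
    (hphi : defining_function L ip S N U phi)
    (e : 'I_m.-1 -> G -> 'rV[R]_n)
    (he : HTS_frame L ip b S N (V 1%N) g e) :
  [/\ Hmean ip b N nabla e g =
        \sum_(i < m) lder L (tnth b i) (pbar_ext L ip b phi i) g,
      forall ub : 'I_m -> G -> R,
        (forall i, C1_extension L S g
                     (fun h => ip (nuH ip b N h) (tnth b i)) (ub i)) ->
        Hmean ip b N nabla e g =
          \sum_(i < m) hsgrad L ip b N i (ub i) g &
      forall ub : 'I_m -> G -> R,
        (forall i, C1_extension L S g (pbar ip b N i) (ub i)) ->
        Hmean ip b N nabla e g =
          \sum_(i < m) hsgrad L ip b N i (ub i) g].
Proof.
have ipP := carnot_ip hG.
have pbarP (ub : 'I_m -> G -> R) :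
    (forall i, C1_extension L S g (pbar ip b N i) (ub i)) ->
    Hmean ip b N nabla e g = \sum_(i < m) hsgrad L ip b N i (ub i) g.
  move=> ubP; apply: (Hmean_extension hG hnabla hb hg hU hphi he) => j.
    exact: Ck1_differentiable (ubP j).1.
  exact: (ubP j).2.
split=> // [|ub ubP].
  (* The first formula is the case of the extension [pbar_ext]. *)
  rewrite -(sum_hsgrad_pbar_ext hG hb hg hU hphi).
  apply: (Hmean_extension hG hnabla hb hg hU hphi he) => j.
    exact: (pbar_ext_differentiable hG hb hg hU hphi).
  have [oU _ _ _] := hphi.
  have nU : nbhs g U by exact: open_nbhs_nbhs.
  by apply: filterS nU => h Uh Sh; exact: (pbar_ext_pbar hG hb hphi).
(* <nu^H, X_i> is the i-th component of nu^H, the basis being orthonormal. *)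
apply: pbarP => i; have [C1 ext] := ubP i; split=> //.
apply: filterS ext => h uE /uE ->.
exact: (ip_lincomb _ ipP hb.2).
Qed.
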